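(* Let $\mathcal H$ be a real Hilbert space, let $(\mathcal G_i)_{i\in\mathbb I}$ be a finite family of real Hilbert spaces, and let $\overline x\in\mathcal H$. For every $i\in\mathbb I$, let $\beta_i\in\,]0,+\infty[$, let $Q_i\colon\mathcal G_i\to\mathcal G_i$ be $\beta_i$-cocoercive, let $L_i\colon\mathcal H\to\mathcal G_i$ be a nonzero bounded linear operator, and define $q_i=Q_i(L_i\overline x)$. Set $$\beta=\frac{1}{\sum_{i\in\mathbb I}\frac{\|L_i\|^2}{\beta_i}},\qquad p=\beta\sum_{i\in\mathbb I}L_i^*q_i,\qquad F=\beta\sum_{i\in\mathbb I}L_i^*\circ Q_i\circ L_i.$$ Then the following hold: (i) $p$ is the proximal point of $\overline x$ relative to $F$, i.e., $F$ is firmly nonexpansive and $p=F\overline x$. (ii) $(\forall x\in\mathcal H)$ $Fx=p$ $\Leftrightarrow$ $(\forall i\in\mathbb I)$ $Q_i(L_ix)=q_i$.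
   Context: An operator $F\colon\mathcal H\to\mathcal H$ is firmly nonexpansive if $(\forall x,y\in\mathcal H)$ $\|Fx-Fy\|^2+\|(\mathrm{Id}-F)x-(\mathrm{Id}-F)y\|^2\leq\|x-y\|^2$. Given $\beta\in\,]0,+\infty[$, an operator $Q\colon\mathcal G\to\mathcal G$ on a real Hilbert space $\mathcal G$ is $\beta$-cocoercive if $(\forall x,y\in\mathcal G)$ $\langle x-y\mid Qx-Qy\rangle\geq\beta\|Qx-Qy\|^2$. A point $p$ is called the proximal point of $\overline x$ relative to a firmly nonexpansive operator $F\colon\mathcal H\to\mathcal H$ if $p=F\overline x$. $L^*$ denotes the adjoint of a bounded linear operator $L$. *)

(* Defs.v *)
From HB Require Import structures.
From mathcomp Require Import all_boot all_order all_algebra.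
From mathcomp Require Import all_classical all_reals all_analysis.

Set Implicit Arguments.
Unset Strict Implicit.
Unset Printing Implicit Defensive.

Import Order.TTheory GRing.Theory Num.Theory.
Import numFieldNormedType.Exports.

Local Open Scope classical_set_scope.
Local Open Scope ring_scope.

HB.mixin Record CompleteNormedModule_isHilbert (R : realType) (V : Type)
    of CompleteNormedModule R V := {
  inner : {dot V for (@idfun R)};
  inner_normE : forall x : V, inner x x = `|x| ^+ 2
}.

#[short(type="hilbertType")]
HB.structure Definition Hilbert (R : realType) :=
  {V of CompleteNormedModule_isHilbert R V & CompleteNormedModule R V}.

Section operators.
Variable R : realType.

Definition firmly_nonexpansive (H : hilbertType R) (F : H -> H) : Prop :=
  forall x y : H,
    `|F x - F y| ^+ 2 + `|(x - F x) - (y - F y)| ^+ 2 <= `|x - y| ^+ 2.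

Definition cocoercive (G : hilbertType R) (beta : R) (Q : G -> G) : Prop :=
  forall x y : G, beta * `|Q x - Q y| ^+ 2 <= inner (x - y) (Q x - Q y).

Definition proximal_point (H : hilbertType R) (F : H -> H) (xbar p : H) : Prop :=
  firmly_nonexpansive F /\ p = F xbar.

Definition opnorm (V W : normedModType R) (L : V -> W) : R :=
  sup [set `|L x| | x in [set x : V | `|x| <= 1]].

(* For a bounded linear L, the Riesz representation theorem gives existence
   (and definiteness of the inner product gives uniqueness) of the vector z
   selected here; get is a total choice operator. *)
Definition adjoint (H G : hilbertType R) (L : H -> G) (y : G) : H :=
  get [set z : H | forall x : H, inner (L x) y = inner x z].

End operators.

(* Main.v *)
Require Import Defs.
From HB Require Import structures.
From mathcomp Require Import all_boot all_order all_algebra.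
From mathcomp Require Import all_classical all_reals all_analysis.
From mathcomp Require Import ring lra.

Set Implicit Arguments.
Unset Strict Implicit.
Unset Printing Implicit Defensive.

Import Order.TTheory GRing.Theory Num.Theory.
Import numFieldNormedType.Exports.

Local Open Scope classical_set_scope.
Local Open Scope ring_scope.

(* The inequality |sum_i L_i^* d_i|^2 <= beta^-1 * sum_i beta_i |d_i|^2, applied
   to d_i = Q_i (L_i x) - Q_i (L_i y), combines with the cocoercivity of the Q_i
   into |F x - F y|^2 <= beta * sum_i <L_i (x - y), d_i> = <x - y, F x - F y>,
   which is firm nonexpansiveness.  If F x = F y, then the inner product
   vanishes, hence so does sum_i beta_i |d_i|^2, and every d_i is 0.
   Adjoints exist by the Riesz representation theorem, obtained by minimizing
   |x|^2 - 2 f x. *)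

Section inner_product.
Variables (R : realType) (H : hilbertType R).
Implicit Types x y z : H.

Lemma innerC x y : inner x y = inner y x.
Proof. by rewrite hermC expr0 mul1r. Qed.

Lemma innerZl (a : R) x y : inner (a *: x) y = a * inner x y.
Proof. exact: linearZl_LR. Qed.

Lemma innerBr x y z : inner x (y - z) = inner x y - inner x z.
Proof. exact: linearBr. Qed.

Lemma innerZr (a : R) x y : inner x (a *: y) = a * inner x y.
Proof. by rewrite innerC innerZl innerC. Qed.

Lemma normD_sqr x y : `|x + y| ^+ 2 = `|x| ^+ 2 + 2 * inner x y + `|y| ^+ 2.
Proof.
rewrite -!inner_normE linearDl !linearDr /= (innerC y x); ring.
Qed.

Lemma normB_sqr x y : `|x - y| ^+ 2 = `|x| ^+ 2 - 2 * inner x y + `|y| ^+ 2.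
Proof. by rewrite normD_sqr normrN linearNr mulrN. Qed.

Lemma inner_le_norm x y : inner x y <= `|x| * `|y|.
Proof.
have [->|x0] := eqVneq x 0; first by rewrite linear0l normr0 mul0r.
have [->|y0] := eqVneq y 0; first by rewrite linear0r normr0 mulr0.
have xy0 : 0 < `|x| * `|y| by rewrite mulr_gt0 ?normr_gt0.
(* Expanding this square gives [2 * |x||y| * (|x||y| - <x,y>) >= 0]; the positive factor cancels. *)
have := sqr_ge0 `| `|y| *: x - `|x| *: y |.
rewrite normB_sqr !normrZ !normr_id innerZl innerZr /= => h.
by rewrite -(ler_pM2l xy0); nra.
Qed.

Lemma ler_norm_inner x y : `|inner x y| <= `|x| * `|y|.
Proof.
by rewrite ler_norml inner_le_norm lerNl -linearNl -(normrN x) inner_le_norm.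
Qed.

Lemma inner_injr y z : (forall x, inner x y = inner x z) -> y = z.
Proof.
move=> yz; apply/eqP; rewrite -subr_eq0 -normr_eq0 -sqrf_eq0 -inner_normE.
by rewrite innerBr yz subrr.
Qed.

End inner_product.

(** * Riesz representation of bounded functionals *)

Section Riesz.
Variables (R : realType) (H : hilbertType R) (f : H -> R) (C : R).
Hypothesis f_scalar : scalar f.
Hypothesis f_bounded : forall x, `|f x| <= C * `|x|.

Let fD x y : f (x + y) = f x + f y.
Proof. by rewrite -[x]scale1r f_scalar mul1r scale1r. Qed.

Let fZ a x : f (a *: x) = a * f x.
Proof.
have f0 : f 0 = 0 by apply: (addrI (f 0)); rewrite -fD !addr0.
by rewrite -[a *: x]addr0 f_scalar f0 addr0.
Qed.

(** If [f] is represented by [z], this is [|x - z|^2 - |z|^2], so the representer is the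
    minimizer. *)
Let J (x : H) : R := `|x| ^+ 2 - 2 * f x.

Let J_ge x : - C ^+ 2 <= J x.
Proof.
rewrite /J; have := f_bounded x; rewrite ler_norml => /andP[_ h].
by have := sqr_ge0 (`|x| - C); nra.
Qed.

(** Parallelogram law: the linear terms cancel at the midpoint. *)
Let J_mid x y : J x + J y - 2 * J (2^-1 *: (x + y)) = 2^-1 * `|x - y| ^+ 2.
Proof.
rewrite /J fZ fD normrZ exprMn (normD_sqr x y) normB_sqr.
by rewrite (ger0_norm (_ : 0 <= 2^-1 :> R)) ?invr_ge0//; field.
Qed.

Let m := inf (range J).

Let J_has_inf : has_inf (range J).
Proof.
split; first by exists (J 0), 0.
by exists (- C ^+ 2) => _ [x _ <-]; exact: J_ge.
Qed.

Let m_le x : m <= J x.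
Proof. by apply: ge_inf; [exact: J_has_inf.2 | exists x]. Qed.

(** The midpoint value is at least [m], so [J_mid] forces near-minimizers to be close; minimizing
    sequences are thus Cauchy. *)
Let min_dist x y (e : R) : J x <= m + e -> J y <= m + e -> `|x - y| ^+ 2 <= 4 * e.
Proof. by move=> hx hy; have := J_mid x y; have := m_le (2^-1 *: (x + y)); lra. Qed.

Let J_cvg (u : nat -> H) z : u @ \oo --> z -> J \o u @ \oo --> J z.
Proof.
move=> uz; apply: cvgB.
  by rewrite /= expr2; under eq_fun do rewrite expr2; apply: cvgM; exact: cvg_norm.
apply: cvgMr; apply/cvgrPdist_le => e e0.
(* The sign of [C] is unknown; [|C| + 1] is a positive Lipschitz constant for [f]. *)
have C0 : 0 < `|C| + 1 by rewrite ltr_wpDl.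
have /cvgrPdist_le/(_ (e / (`|C| + 1)) (divr_gt0 e0 C0)) := uz.
apply: filterS => n; rewrite ler_pdivlMr// => h.
have -> : f z - f (u n) = f (z - u n) by rewrite fD -[- u n]scaleN1r fZ mulN1r.
apply: (le_trans (f_bounded _)); apply: le_trans h; rewrite mulrC.
by rewrite ler_wpM2l// (le_trans (ler_norm _))// lerDl.
Qed.

Let J_min : exists z, J z = m.
Proof.
have /choice[u Ju] : forall n : nat, exists x, J x <= m + n.+1%:R^-1.
  move=> n; have n0 : 0 < n.+1%:R^-1 :> R by rewrite invr_gt0.
  have [_ [x _ <-] /ltW ?] := inf_adherent n0 J_has_inf; by exists x.
have u_near (e : R) : 0 < e -> exists N, forall n, (N <= n)%N -> J (u n) <= m + e.
  move=> e0; have [N _ hN] := near_infty_natSinv_lt (PosNum e0).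
  exists N => n /hN /= ne; apply: (le_trans (Ju n)); rewrite lerD2l; exact: ltW.
have /cauchy_cvgP u_cvg : cauchy (u @ \oo).
  apply: cauchy_exP => e e0.
  (* With tolerance [e^2 / 5], [min_dist] bounds the squared distance by [4 e^2 / 5], strictly below
     [e^2]. *)
  have [|N hN] := u_near (e ^+ 2 / 5); first by rewrite divr_gt0 ?exprn_gt0.
  exists (u N), N => // n /= Nn.
  rewrite -ball_normE /= -(ltr_pXn2r (_ : 0 < 2)%N) ?nnegrE ?(ltW e0)//.
  apply: (le_lt_trans (min_dist (hN _ (leqnn N)) (hN _ Nn))).
  by have : 0 < e ^+ 2; [rewrite exprn_gt0 | lra].
exists (lim (u @ \oo)); apply/eqP; rewrite eq_le m_le andbT.
apply/ler_addgt0Pr => e e0; have [N hN] := u_near e e0.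
rewrite -(cvg_lim _ (J_cvg u_cvg))//; apply: limr_le.
  by apply/cvg_ex; eexists; exact: J_cvg u_cvg.
by exists N => // n; exact: hN.
Qed.

Lemma Riesz_representation : exists z, forall x, f x = inner x z.
Proof.
have [z Jz] := J_min; exists z => x.
(* Minimality of [z] along the line [z + t x]. *)
have h t : 0 <= t ^+ 2 * `|x| ^+ 2 + 2 * t * (inner x z - f x).
  have := m_le (z + t *: x); rewrite -Jz /J normD_sqr fD fZ normrZ exprMn.
  by rewrite innerZr innerC real_normK ?num_real//; lra.
set d := inner x z - f x in h.
(* The [+ 1] keeps the denominator positive even for [x = 0]; at this [t] the quadratic is a
   negative multiple of [d^2], hence [d = 0]. *)
have := h (- d / (`|x| ^+ 2 + 1)).
have x1 : 0 < `|x| ^+ 2 + 1 by rewrite ltr_wpDl ?sqr_ge0.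
have -> : (- d / (`|x| ^+ 2 + 1)) ^+ 2 * `|x| ^+ 2 +
    2 * (- d / (`|x| ^+ 2 + 1)) * d
    = - (d ^+ 2 * (`|x| ^+ 2 + 2) / (`|x| ^+ 2 + 1) ^+ 2).
  by field; rewrite gt_eqF.
rewrite oppr_ge0 pmulr_lle0 ?invr_gt0 ?exprn_gt0// pmulr_lle0; last first.
  by rewrite ltr_wpDl ?sqr_ge0.
move=> d0; have /eqP : d ^+ 2 = 0 by apply/eqP; rewrite eq_le d0 sqr_ge0.
by rewrite sqrf_eq0 subr_eq0 => /eqP.
Qed.

End Riesz.

(** * Operator norm and adjoint *)

Section bounded_operator.
Variables (R : realType) (H G : hilbertType R) (L : {linear H -> G}).
Hypothesis L_bounded : bounded_near L (nbhs (0 : H)).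

Let L_le : exists2 C : R, 0 < C & forall x, `|L x| <= C * `|x|.
Proof.
have /linear_boundedP L_near := L_bounded.
near (pinfty_nbhs R) => C; exists C; first by near: C; exact: nbhs_pinfty_gt.
by near: C.
Unshelve. all: by end_near. Qed.

Lemma ler_opnorm x : `|L x| <= opnorm L * `|x|.
Proof.
have [->|x0] := eqVneq x 0; first by rewrite linear0 !normr0 mulr0.
have nx : 0 < `|x| by rewrite normr_gt0.
rewrite -ler_pdivrMr// /opnorm; apply: ub_le_sup.
  (* Boundedness of [L] makes the supremum a genuine one rather than a default value. *)
  have [C C0 hC] := L_le; exists C => _ [y /= y1 <-].
  by rewrite (le_trans (hC y))// ler_piMr// ltW.
exists (`|x|^-1 *: x).
  by rewrite /= normrZ normfV normr_id mulVf// gt_eqF.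
by rewrite linearZ /= normrZ normfV normr_id mulrC.
Qed.

Lemma opnorm_gt0 : (exists x, L x != 0) -> 0 < opnorm L.
Proof.
move=> [x Lx0]; have := ler_opnorm x.
have nLx : 0 < `|L x| by rewrite normr_gt0.
by move=> /(lt_le_trans nLx); apply: contraTT; rewrite -!leNgt => /mulr_le0_ge0; exact.
Qed.

(** Riesz applies to [w |-> <L w, y>], bounded by [C |y| |w|], so the choice in [adjoint] selects an
    actual representer. *)
Lemma adjointP y x : inner (L x) y = inner x (adjoint L y).
Proof.
have [C C0 hC] := L_le.
have /getPex : [set z | forall w, inner (L w) y = inner w z] !=set0; last exact.
apply: (@Riesz_representation _ _ _ (C * `|y|)) => [a u v|w].
  by rewrite linearP linearDl /= innerZl.
by rewrite (le_trans (ler_norm_inner _ _))// mulrAC ler_wpM2r.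
Qed.

Lemma adjointB u v : adjoint L (u - v) = adjoint L u - adjoint L v.
Proof. by apply: inner_injr => x; rewrite innerBr -!adjointP innerBr. Qed.

End bounded_operator.

(** * The norm estimate for sums of adjoints *)

Section family.
Variables (R : realType) (H : hilbertType R) (I : finType).
Variables (G : I -> hilbertType R) (beta_ : I -> R).
Variable L : forall i : I, {linear H -> G i}.
Hypothesis beta_gt0 : forall i, 0 < beta_ i.
Hypothesis L_bounded : forall i, bounded_near (L i) (nbhs (0 : H)).

Lemma inner_sum_adjoint (d : forall i, G i) x :
  inner x (\sum_i adjoint (L i) (d i)) = \sum_i inner (L i x) (d i).
Proof. by rewrite linear_sumr; apply: eq_bigr => i _; rewrite adjointP. Qed.

Let T := \sum_i opnorm (L i) ^+ 2 / beta_ i.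

(** Testing the sum [S] against itself gives [|S|^2 = sum_i <L_i S, d_i>]; each term is split by a
    weighted AM-GM inequality. *)
Lemma norm_sum_adjoint_le (d : forall i, G i) : 0 < T ->
  `|\sum_i adjoint (L i) (d i)| ^+ 2 <= T * \sum_i beta_ i * `|d i| ^+ 2.
Proof.
move=> T0; set S := \sum_i adjoint _ _; set s := `|S|.
(* AM-GM: [2 a s |d| <= a^2 s^2 / (b T) + T b |d|^2] with [a = opnorm L_i]. *)
have step i : 2 * inner (L i S) (d i) <=
    s ^+ 2 / T * (opnorm (L i) ^+ 2 / beta_ i) + T * (beta_ i * `|d i| ^+ 2).
  have b0 := beta_gt0 i.
  have le1 : inner (L i S) (d i) <= opnorm (L i) * s * `|d i|.
    by rewrite (le_trans (inner_le_norm _ _))// ler_wpM2r// ler_opnorm.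
  have : 0 <= (opnorm (L i) * s - T * beta_ i * `|d i|) ^+ 2 / (beta_ i * T).
    by rewrite divr_ge0 ?sqr_ge0// mulr_ge0 ?ltW.
  have -> : (opnorm (L i) * s - T * beta_ i * `|d i|) ^+ 2 / (beta_ i * T) =
      s ^+ 2 / T * (opnorm (L i) ^+ 2 / beta_ i) + T * (beta_ i * `|d i| ^+ 2)
      - 2 * (opnorm (L i) * s * `|d i|).
    by field; rewrite !gt_eqF.
  by lra.
(* The weights [opnorm L_i ^ 2 / beta_i] add up to [T], so the first terms of [step] sum to
   [s^2]. *)
have : 2 * s ^+ 2 <= s ^+ 2 + T * \sum_i beta_ i * `|d i| ^+ 2.
  rewrite -{1}inner_normE {2}/S inner_sum_adjoint mulr_sumr.
  have -> : s ^+ 2 = s ^+ 2 / T * T by rewrite divfK// gt_eqF.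
  by rewrite !mulr_sumr -big_split; apply: ler_sum => i _; exact: step.
by lra.
Qed.

End family.

Lemma firmly_nonexpansive_inner (R : realType) (H : hilbertType R) (F : H -> H) :
  (forall x y, `|F x - F y| ^+ 2 <= inner (x - y) (F x - F y)) ->
  firmly_nonexpansive F.
Proof.
move=> hF x y; have -> : x - F x - (y - F y) = (x - y) - (F x - F y).
  by rewrite (opprD y) addrACA -opprD.
by rewrite [X in _ + X]normB_sqr; have := hF x y; lra.
Qed.

Theorem proposition2p8 (R : realType) (H : hilbertType R)
    (I : finType) (G : I -> hilbertType R) (xbar : H)
    (beta_ : I -> R) (Q : forall i : I, G i -> G i)
    (L : forall i : I, {linear H -> G i})
    (beta_gt0 : forall i : I, 0 < beta_ i)
    (Q_coco : forall i : I, cocoercive (beta_ i) (Q i))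
    (L_bounded : forall i : I, bounded_near (L i) (nbhs (0 : H)))
    (L_neq0 : forall i : I, exists x : H, L i x != 0) :
  let q := fun i : I => Q i (L i xbar) in
  let beta := 1 / (\sum_(i : I) opnorm (L i) ^+ 2 / beta_ i) in
  let p := beta *: \sum_(i : I) adjoint (L i) (q i) in
  let F := fun x : H => beta *: \sum_(i : I) adjoint (L i) (Q i (L i x)) in
  proximal_point F xbar p /\
  (forall x : H, F x = p <-> forall i : I, Q i (L i x) = q i).
Proof.
move=> q beta p F; pose T := \sum_i opnorm (L i) ^+ 2 / beta_ i.
pose d x y i := Q i (L i x) - Q i (L i y).
have term_gt0 i : 0 < opnorm (L i) ^+ 2 / beta_ i.
  by rewrite divr_gt0// exprn_gt0// opnorm_gt0.
(* The index witnesses that [I] is nonempty; for empty [I], [T] is 0 and so is [beta]. *)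
have T_gt0 (i : I) : 0 < T.
  by rewrite /T (bigD1 i)//= ltr_pwDl// sumr_ge0// => j _; exact: ltW.
have FB x y : F x - F y = beta *: \sum_i adjoint (L i) (d x y i).
  rewrite -scalerBr -sumrB; congr (_ *: _).
  by apply: eq_bigr => i _; rewrite adjointB.
(* Cocoercivity at [L_i x] and [L_i y], summed over [i], with each [L_i] moved across the inner
   product. *)
have coco x y : \sum_i beta_ i * `|d x y i| ^+ 2 <=
    inner (x - y) (\sum_i adjoint (L i) (d x y i)).
  rewrite inner_sum_adjoint//; apply: ler_sum => i _.
  by rewrite (linearB (L i)); exact: Q_coco.
split; first split=> //.
  apply: firmly_nonexpansive_inner => x y; rewrite FB.
  (* For an empty family [F] is zero and both sides vanish. *)
  have [i _|I0] := pickP (mem I); last first.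
    by rewrite big_pred0// scaler0 normr0 linear0r expr0n.
  rewrite innerZr normrZ exprMn real_normK ?num_real//.
  have beta0 : 0 < beta by rewrite divr_gt0// (T_gt0 i).
  (* After cancelling one [beta], [sum_i beta_i |d_i|^2] separates the two sides. *)
  rewrite expr2 -mulrA ler_pM2l//; apply: le_trans (coco x y).
  rewrite /beta mulrC mul1r ler_pdivrMr ?(T_gt0 i)// mulrC.
  by apply: norm_sum_adjoint_le => //; exact: (T_gt0 i).
move=> x; split=> [Fxp i|Qx]; last first.
  by congr (_ *: _); apply: eq_bigr => i _; rewrite Qx.
have beta0 : 0 < beta by rewrite divr_gt0// (T_gt0 i).
have /eqP : F x - F xbar = 0 by apply/eqP; rewrite subr_eq0 Fxp.
rewrite FB scaler_eq0 gt_eqF//= => /eqP S0.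
have dge0 j : 0 <= beta_ j * `|d x xbar j| ^+ 2.
  by rewrite mulr_ge0 ?sqr_ge0// ltW.
(* [coco] bounds this nonnegative sum by [<x - xbar, 0> = 0], so each term vanishes. *)
have /eqP : \sum_j beta_ j * `|d x xbar j| ^+ 2 = 0.
  apply/eqP; rewrite eq_le sumr_ge0// andbT.
  by rewrite (le_trans (coco _ _))// S0 linear0r.
rewrite psumr_eq0// => /allP/(_ i (mem_index_enum _))/=.
by rewrite mulf_eq0 gt_eqF//= sqrf_eq0 normr_eq0 subr_eq0 => /eqP.
Qed.
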